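(* Let $k:[0,+\infty)\to[0,+\infty)$ be a convex, strictly increasing function, continuous at $0$, with $k(0)=0$, and let $g:[0,+\infty)\to[0,+\infty)$ be the invertible function whose inverse is $g^{-1}(t)=k(t)+t^{2}$. Let $\rho$ be the left invariant distance on the Heisenberg group $H(1)$ determined by $\rho(\tilde x)=\max\{\|x\|,g(|\bar x|)\}$ for $\tilde x=(x,\bar x)$, and let $\bar\delta$ be the field of dilatations on $H(1)$ given by $\bar\delta^{\tilde x}_{\varepsilon}\tilde y=\tilde x\,\bar\delta_\varepsilon(\tilde x^{-1}\tilde y)$, where $\bar\delta_\varepsilon(x,\bar x)=\left(\varepsilon x,\ \mathrm{sgn}(\bar x)\,g^{-1}(\varepsilon\, g(|\bar x|))\right)$ for $\varepsilon>0$. Then the structure $(H(1),\rho,\bar\delta)$ satisfies the axioms A0, A1, A2 of dilatation structures. Moreover, if $(H(1),\rho,\bar\delta)$ satisfies axiom A4, then it satisfies axiom A3.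
   Context: Heisenberg group: $H(1)=\mathbb{R}^2\times\mathbb{R}$, with elements written $\tilde x=(x,\bar x)$, $x\in\mathbb{R}^2$, $\bar x\in\mathbb{R}$, and group operation $(x,\bar x)(y,\bar y)=(x+y,\ \bar x+\bar y+2\omega(x,y))$, where $\omega$ is the canonical symplectic form on $\mathbb{R}^2$; $\|\cdot\|$ is the Euclidean norm on $\mathbb{R}^2$ and the neutral element is $(0,0)$. The distance $\rho$: the same symbol denotes the function $\rho(\tilde x)=\max\{\|x\|,g(|\bar x|)\}$ and the distance $\rho(\tilde x,\tilde y)=\rho(\tilde x^{-1}\tilde y)$. It is a known theorem of Kirchheim and Magnani that, for $g$ as in the claim, this is a left invariant distance on $H(1)$. Axioms of dilatation structures. Let $(X,d)$ be a complete metric space in which closed balls are compact, and suppose that to every $x\in X$ and $\varepsilon\in(0,+\infty)$ is assigned a homeomorphism $\delta^x_\varepsilon:X\to X$ (in the general definition the dilatations may be only locally defined; here they are globally defined and the neighbourhoods below are domains to which they are restricted). Write $B_d(x,r)$, $\bar B_d(x,r)$ for open and closed balls. A0. There are numbers $1<A<B$ and, for every $x\in X$, open neighbourhoods $U(x)$ of $x$, $V_\varepsilon(x)$ of $x$ (for $\varepsilon\in(0,1]$) and $W_\varepsilon(x)$ of $x$ (for $\varepsilon>1$), such that $\bar B_d(x,A)\subset U(x)$, $\delta^x_\varepsilon$ restricts to a homeomorphism from $U(x)$ onto $V_\varepsilon(x)$ for $\varepsilon\in(0,1]$, and for all $\varepsilon\in(0,1)$: $B_d(x,\varepsilon)\subset\delta^x_\varepsilon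 B_d(x,A)\subset V_\varepsilon(x)\subset W_{\varepsilon^{-1}}(x)\subset\delta^x_\varepsilon B_d(x,B)$. Moreover, for any compact $K\subset X$ there are $R=R(K)>0$ and $\varepsilon_0=\varepsilon_0(K)\in(0,1)$ such that for all $x\in K$, all $u,v\in\bar B_d(x,R)$ and all $\varepsilon\in(0,\varepsilon_0)$, $\delta^x_\varepsilon v\in W_{\varepsilon^{-1}}(\delta^x_\varepsilon u)$. A1. $\delta^x_\varepsilon x=x$ and $\delta^x_1=\mathrm{id}$ for all $x$ and $\varepsilon$; the map $(\varepsilon,x,y)\mapsto\delta^x_\varepsilon y$ is continuous on $(0,+\infty)\times X\times X$ and extends continuously to $\varepsilon=0$ with $\lim_{\varepsilon\to0}\delta^x_\varepsilon y=x$. A2. $\delta^x_\varepsilon\delta^x_\mu u=\delta^x_{\varepsilon\mu}u$ for all $x,u\in X$ and $\varepsilon,\mu\in(0,+\infty)$. A3. There is $A>1$ (the one in A0) such that for each $x\in X$ there is a function $(u,v)\mapsto d^x(u,v)$ defined on $\bar B_d(x,A)\times\bar B_d(x,A)$ with $\lim_{\varepsilon\to0}\sup\left\{\left|\frac1\varepsilon d(\delta^x_\varepsilon u,\delta^x_\varepsilon v)-d^x(u,v)\right| : u,v\in\bar B_d(x,A)\right\}=0$, uniformly with respect to $x$ in compact sets. A4. With $\Delta^x_\varepsilon(u,v)=\delta^{\delta^x_\varepsilon u}_{\varepsilon^{-1}}\delta^x_\varepsilon v$, the limit $\lim_{\varepsilon\to0}\Delta^x_\varepsilon(u,v)=\Delta^x(u,v)$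 exists, uniformly with respect to $x,u,v$ in compact sets. For $(H(1),\rho,\bar\delta)$, by left invariance, A4 takes the following form: with $\bar\beta_\varepsilon(\tilde x,\tilde y)=\bar\delta_{\varepsilon^{-1}}\left(\bar\delta_\varepsilon(\tilde x)\,\bar\delta_\varepsilon(\tilde y)\right)$, the limit $\lim_{\varepsilon\to0}\bar\beta_\varepsilon(\tilde x,\tilde y)=\bar\beta(\tilde x,\tilde y)\in H(1)$ exists, uniformly with respect to $\tilde x,\tilde y$ in any compact set $K$. *)

(* Defs.v *)
From HB Require Import structures.
From mathcomp Require Import all_boot all_order all_algebra.
From mathcomp Require Import all_classical all_reals all_analysis.
From mathcomp Require Import ring lra.
Import Order.TTheory GRing.Theory Num.Theory.
Import numFieldNormedType.Exports.

Set Implicit Arguments.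
Unset Strict Implicit.
Unset Printing Implicit Defensive.

Local Open Scope classical_set_scope.
Local Open Scope ring_scope.

Section DilatationStructures.
Variables (R : realType) (X : metricType R).

(* The library's [closed_ball] is the closure of the open ball, which in a
   general metric space can be smaller than this set. *)
Definition cball (x : X) (r : R) : set X := [set y | mdist x y <= r].

Definition homeo_on (U V : set X) (f : X -> X) :=
  [/\ set_bij U V f, {within U, continuous f} &
      exists2 h : X -> X, {within V, continuous h} & {in U, cancel f h}].

(* [delta x e] is the dilatation of centre [x] and coefficient [e]; only its
   values for [0 < e] matter. *)
Variable delta : X -> R -> X -> X.

Definition dilatation_setting :=
  [/\ forall F : set_system X, ProperFilter F -> cauchy F ->
        exists l : X, F --> l,
      forall (x : X) (r : R), compact (cball x r) &
      forall (x : X) (e : R), 0 < e -> homeo_on setT setT (delta x e)].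

(* The constants [A] and [B] are parameters because A3 refers to the same [A]. *)
Definition axiom_A0 (A B : R) :=
  [/\ 1 < A, A < B &
  exists (U : X -> set X) (V W : X -> R -> set X),
   [/\ [/\ forall x, open_nbhs x (U x),
           forall x e, 0 < e <= 1 -> open_nbhs x (V x e) &
           forall x e, 1 < e -> open_nbhs x (W x e)],
       forall x, cball x A `<=` U x,
       forall x e, 0 < e <= 1 -> homeo_on (U x) (V x e) (delta x e),
       forall x e, 0 < e < 1 ->
         [/\ ball x e `<=` delta x e @` ball x A,
             delta x e @` ball x A `<=` V x e,
             V x e `<=` W x e^-1 &
             W x e^-1 `<=` delta x e @` ball x B] &
       forall K : set X, compact K ->
         exists (r e0 : R), [/\ 0 < r, 0 < e0 < 1 &
           forall (x u v : X) (e : R), K x -> cball x r u -> cball x r v ->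
             0 < e < e0 -> W (delta x e u) e^-1 (delta x e v)]]].

Definition axiom_A1 :=
  [/\ forall x e, 0 < e -> delta x e x = x,
      forall x y, delta x 1 y = y,
      {within [set p : R * X * X | 0 < p.1.1],
        continuous (fun p : R * X * X => delta p.1.2 p.1.1 p.2)} &
      {within [set p : R * X * X | 0 <= p.1.1],
        continuous (fun p : R * X * X =>
          if 0 < p.1.1 then delta p.1.2 p.1.1 p.2 else p.1.2)}].

Definition axiom_A2 :=
  forall (x u : X) (e m : R), 0 < e -> 0 < m ->
    delta x e (delta x m u) = delta x (e * m) u.

(* The supremum is taken in the extended reals, so that it is [+oo], and not a
   default value, when the set is unbounded. *)
Definition axiom_A3 (A : R) :=
  1 < A /\
  exists d0 : X -> X -> X -> R,
    forall K : set X, compact K -> forall eta : R, 0 < eta ->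
      \forall e \near 0^'+, forall x, K x ->
        (ereal_sup
           [set (`|e^-1 * mdist (delta x e p.1) (delta x e p.2)
                   - d0 x p.1 p.2|)%:E | p in cball x A `*` cball x A]
         < eta%:E)%E.

Definition approx_difference (x : X) (e : R) (u v : X) : X :=
  delta (delta x e u) e^-1 (delta x e v).

Definition axiom_A4 :=
  exists D : X -> X -> X -> X,
    forall K : set X, compact K -> forall eta : R, 0 < eta ->
      \forall e \near 0^'+, forall x u v, K x -> K u -> K v ->
        mdist (approx_difference x e u v) (D x u v) < eta.

End DilatationStructures.

(* The triple [((a, b), c)] stands for the point with horizontal part [(a, b)]
   and vertical part [c]. *)
Definition heisenberg (R : realType) : Type := (R * R * R)%type.

Section HeisenbergGroup.
Variable R : realType.
Local Notation H := (heisenberg R).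

HB.instance Definition _ := Choice.on H.

Definition symp (x y : R * R) : R := x.1 * y.2 - x.2 * y.1.
Definition hone : H := (0, 0, 0).
Definition hinv (x : H) : H := (- x.1.1, - x.1.2, - x.2).
Definition hmul (x y : H) : H :=
  (x.1.1 + y.1.1, x.1.2 + y.1.2, x.2 + y.2 + 2 * symp x.1 y.1).

Lemma hmulA : associative hmul.
Proof.
move=> [[a b] c] [[a' b'] c'] [[a'' b''] c''].
by rewrite /hmul /symp /=; congr (_, _, _); ring.
Qed.

Lemma hmul1g : left_id hone hmul.
Proof. by move=> [[a b] c]; rewrite /hmul /symp /=; congr (_, _, _); ring. Qed.

Lemma hmulg1 : right_id hone hmul.
Proof. by move=> [[a b] c]; rewrite /hmul /symp /=; congr (_, _, _); ring. Qed.

Lemma hmulVg : left_inverse hone hinv hmul.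
Proof.
by move=> [[a b] c]; rewrite /hmul /symp /hone /=; congr (_, _, _); ring.
Qed.

Lemma hmulgV : right_inverse hone hinv hmul.
Proof.
by move=> [[a b] c]; rewrite /hmul /symp /hone /=; congr (_, _, _); ring.
Qed.

HB.instance Definition _ :=
  isGroup.Build H hmulA hmul1g hmulg1 hmulVg hmulgV.

Definition enorm (x : R * R) : R := Num.sqrt (x.1 ^+ 2 + x.2 ^+ 2).

Lemma enorm_ge0 x : 0 <= enorm x.
Proof. exact: sqrtr_ge0. Qed.

Lemma sqr_enorm x : enorm x ^+ 2 = x.1 ^+ 2 + x.2 ^+ 2.
Proof. by rewrite sqr_sqrtr// addr_ge0// sqr_ge0. Qed.

Lemma symp_le x y : `|symp x y| <= enorm x * enorm y.
Proof.
rewrite -ler_sqr ?nnegrE ?mulr_ge0 ?enorm_ge0// real_normK ?num_real//.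
rewrite exprMn !sqr_enorm /symp -subr_ge0.
rewrite [X in 0 <= X](_ : _ = (x.1 * y.1 + x.2 * y.2) ^+ 2); last by ring.
exact: sqr_ge0.
Qed.

Lemma enormD x y : enorm (x.1 + y.1, x.2 + y.2) <= enorm x + enorm y.
Proof.
have /(le_trans (ler_norm _)) h : `|x.1 * y.1 + x.2 * y.2| <= enorm x * enorm y.
  rewrite -ler_sqr ?nnegrE ?mulr_ge0 ?enorm_ge0// real_normK ?num_real//.
  rewrite exprMn !sqr_enorm -subr_ge0.
  rewrite [X in 0 <= X](_ : _ = symp x y ^+ 2); last by rewrite /symp; ring.
  exact: sqr_ge0.
rewrite -ler_sqr ?nnegrE ?addr_ge0 ?enorm_ge0// sqrrD !sqr_enorm/=.
rewrite mulr2n; nra.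
Qed.

End HeisenbergGroup.

(* [k] and [g] are functions on [0, +oo[; their values at negative arguments
   are irrelevant junk. *)
Record gauge (R : realType) (k g : R -> R) : Prop := Gauge {
  gauge_k_ge0 : forall t, 0 <= t -> 0 <= k t;
  gauge_k_convex : convex_function (`[0, +oo[%classic : set R) k;
  gauge_k_incr : {in `[0, +oo[ &, {homo k : s t / s < t}};
  gauge_k_cvg0 : k t @[t --> 0^'+] --> k 0;
  gauge_k0 : k 0 = 0;
  gauge_g_ge0 : forall s, 0 <= s -> 0 <= g s;
  gauge_gK : forall t, 0 <= t -> g (k t + t ^+ 2) = t;
  gauge_Kg : forall s, 0 <= s -> k (g s) + g s ^+ 2 = s
}.

Definition hgauge (R : realType) (g : R -> R) (x : heisenberg R) : R :=
  Num.max (enorm x.1) (g `|x.2|).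

Definition hdist (R : realType) (g : R -> R) (x y : heisenberg R) : R :=
  hgauge g (x^-1 * y)%g.

Definition hdil0 (R : realType) (k g : R -> R) (e : R) (x : heisenberg R) :
    heisenberg R :=
  let ginv t := k t + t ^+ 2 in
  (e * x.1.1, e * x.1.2, Num.sg x.2 * ginv (e * g `|x.2|)).

Definition hdil (R : realType) (k g : R -> R) (x : heisenberg R) (e : R)
    (y : heisenberg R) : heisenberg R :=
  (x * hdil0 k g e (x^-1 * y))%g.

Section HeisenbergMetric.
Variables (R : realType) (k g : R -> R) (kg : gauge k g).
Local Notation H := (heisenberg R).

Lemma gauge_g_le (s r : R) : 0 <= s -> 0 <= r -> s <= k r + r ^+ 2 -> g s <= r.
Proof.
move=> s0 r0 sr; rewrite leNgt; apply/negP => rg.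
have gs0 := gauge_g_ge0 kg s0.
have := gauge_k_incr kg _ _ rg; rewrite !in_itv/= !andbT => /(_ r0 gs0).
have := gauge_Kg kg s0; nra.
Qed.

Lemma gauge_k_superadd (s t : R) : 0 <= s -> 0 <= t -> k s + k t <= k (s + t).
Proof.
move=> s0 t0.
have [st0|st0] := eqVneq (s + t) 0.
  have -> : s = 0 by lra.
  have -> : t = 0 by lra.
  by rewrite addr0 (gauge_k0 kg) addr0.
have st : 0 < s + t by rewrite lt_neqAle eq_sym st0 addr_ge0.
have key (p : R) : 0 <= p -> p <= s + t -> k p <= p / (s + t) * k (s + t).
  move=> p0 pst.
  have l0 : 0 <= p / (s + t) by rewrite divr_ge0// ltW.
  have l1 : p / (s + t) <= 1 by rewrite ler_pdivrMr// mul1r.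
  have li : Itv.spec (@Itv.num_sem R) (Itv.Real `[0%Z, 1%Z]) (p / (s + t)).
    by rewrite /= /Itv.num_sem/= in_itv/= l0 l1 num_real.
  have /(_ (Itv.mk li) (s + t) 0) := gauge_k_convex kg.
  rewrite !inE/= !in_itv/= !andbT => /(_ (ltW st) (lexx _)).
  rewrite [leRHS]convRE/= (gauge_k0 kg) mulr0 addr0 => h.
  have E : p = p / (s + t) * (s + t) + (1 - p / (s + t)) * 0.
    by rewrite mulr0 addr0 divfK.
  by rewrite {1}E; exact: h.
have ks := key s s0 ltac:(lra).
have kt := key t t0 ltac:(lra).
apply: (le_trans (lerD ks kt)).
by rewrite -mulrDl -mulrDl divff// mul1r.
Qed.

Lemma hgauge_ge0 (x : H) : 0 <= hgauge g x.
Proof. by rewrite le_max enorm_ge0. Qed.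

Lemma hgauge_vert (x : H) :
  `|x.2| <= k (hgauge g x) + hgauge g x ^+ 2.
Proof.
have g0 := gauge_g_ge0 kg (normr_ge0 x.2).
rewrite -{1}(gauge_Kg kg (normr_ge0 x.2)).
have : g `|x.2| <= hgauge g x by rewrite le_max lexx orbT.
rewrite le_eqVlt => /predU1P[->//|lt].
have := gauge_k_incr kg _ _ lt; rewrite !in_itv/= !andbT.
move=> /(_ g0 (hgauge_ge0 x)) ?; nra.
Qed.

Lemma hgaugeM (x y : H) : hgauge g (x * y)%g <= hgauge g x + hgauge g y.
Proof.
have [x0 y0] := (hgauge_ge0 x, hgauge_ge0 y).
have xh : enorm x.1 <= hgauge g x by rewrite le_max lexx.
have yh : enorm y.1 <= hgauge g y by rewrite le_max lexx.
rewrite {1}/hgauge ge_max; apply/andP; split.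
  exact: le_trans (enormD _ _) (lerD xh yh).
apply: gauge_g_le => //; first exact: addr_ge0.
have hs := symp_le x.1 y.1.
have hk := gauge_k_superadd x0 y0.
have [hx hy] := (hgauge_vert x, hgauge_vert y).
apply: (@le_trans _ _ (`|x.2| + `|y.2| + 2 * `|symp x.1 y.1|)).
  rewrite /=; apply: le_trans (ler_normD _ _) _.
  by rewrite normrM (ger0_norm (ler0n _ 2)) lerD2r ler_normD.
have hm : `|symp x.1 y.1| <= hgauge g x * hgauge g y.
  by apply: le_trans hs _; apply: ler_pM => //; exact: enorm_ge0.
nra.
Qed.

Lemma hgaugeV (x : H) : hgauge g (x^-1)%g = hgauge g x.
Proof. by rewrite /hgauge /enorm /= !sqrrN normrN. Qed.

Lemma hgauge_eq0 (x : H) : hgauge g x = 0 -> x = 1%g.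
Proof.
move=> h; have := hgauge_vert x; rewrite h (gauge_k0 kg) expr0n/= addr0.
rewrite normr_le0 => /eqP x2.
have : enorm x.1 <= 0 by rewrite -h le_max lexx.
rewrite le_eqVlt ltNge enorm_ge0 orbF => /eqP e0.
have := sqr_enorm x.1; rewrite e0 expr0n/= => /esym/eqP.
rewrite paddr_eq0 ?sqr_ge0// !sqrf_eq0 => /andP[/eqP a /eqP b].
by case: x x2 a b {h e0} => [[? ?] ?] /= -> -> ->.
Qed.

Lemma hdistxx (x : H) : hdist g x x = 0.
Proof.
rewrite /hdist mulVg; have := gauge_gK kg (lexx 0).
rewrite (gauge_k0 kg) expr0n/= addr0 => g0.
by rewrite /hgauge /enorm /= normr0 g0 expr0n/= addr0 sqrtr0 maxxx.
Qed.

Lemma hdist_positivity (x y : H) : hdist g x y = 0 -> x = y.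
Proof. by move/hgauge_eq0 => h; rewrite -[y](mulVKg x) h mulg1. Qed.

Lemma hdist_sym (x y : H) : hdist g x y = hdist g y x.
Proof. by rewrite /hdist -hgaugeV invgM invgK. Qed.

Lemma hdist_triangle (y x z : H) : hdist g x z <= hdist g x y + hdist g y z.
Proof.
by apply: le_trans (hgaugeM _ _); rewrite mulgA mulgK.
Qed.

End HeisenbergMetric.

(* A copy of the Heisenberg group carrying the metric space structure given by
   [hdist g]. *)
Definition heisenberg_metric (R : realType) (k g : R -> R) (kg : gauge k g) :
  Type := heisenberg R.

HB.instance Definition _ (R : realType) (k g : R -> R) (kg : gauge k g) :=
  Choice.on (heisenberg_metric kg).

HB.instance Definition _ (R : realType) (k g : R -> R) (kg : gauge k g) :=
  isMetric.Build R (heisenberg_metric kg)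
    (hdistxx kg) (@hdist_positivity _ _ _ kg) (hdist_sym g)
    (hdist_triangle kg).

Definition heisenberg_dil (R : realType) (k g : R -> R) (kg : gauge k g) :
    heisenberg_metric kg -> R -> heisenberg_metric kg -> heisenberg_metric kg :=
  hdil k g.

(* Main.v *)
Require Import Defs.
From mathcomp Require Import all_boot all_order all_algebra.
From mathcomp Require Import all_classical all_reals all_analysis.
From mathcomp Require Import lra ring.
Import Order.TTheory GRing.Theory Num.Theory.
Import numFieldNormedType.Exports.

Set Implicit Arguments.
Unset Strict Implicit.
Unset Printing Implicit Defensive.

Local Open Scope classical_set_scope.
Local Open Scope ring_scope.

(** The dilatation of centre [x] and coefficient [e] multiplies the distance
    to its centre by [e]:
      d (x, delta x e y) = e d (x, y)     ([mdist_hdil]),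
    because the gauge of the Heisenberg group is homogeneous for [hdil0].
    Together with the one-parameter group law A2, this identity gives A0 and
    the implication from A4 to A3 for continuous dilatations of any metric space
    whose closed balls are compact.

    For A0 ([conical_A0]), [delta x e] maps the ball of radius [r] around [x]
    onto the ball of radius [e r], so concentric balls with radii in the
    proportions 1, 2, 3, 4, 4 satisfy the chain of inclusions, and the last
    clause is the triangle inequality through [x].

    For A3 ([conical_A3]), write a = delta x e u and let b be the approximate
    difference of u and v.  By A2, delta x e v = delta a e b, so
    d (delta x e u, delta x e v) = e d (a, b).  As e tends to 0, a tends to x
    because d (x, a) = e d (x, u), and b tends to the limit D x u v given by A4,
    all uniformly; hence the rescaled distance tends to d (x, D x u v).

    What is particular to the Heisenberg group is the topology: the distance
    induces the usual topology of the three-dimensional space.  On the vertical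
    axis a dilatation is h^-1 o (multiplication by e) o h, where h is the odd
    extension of g.  Both h and its inverse are increasing bijections of the
    line, hence continuous ([increasing_bijection_continuous]).  From this, the
    identity is continuous from the usual topology to the metric one
    ([of_coords_continuous]) and the coordinates are continuous for the metric
    ([coord2_continuous] being the delicate one, as the group law couples the
    vertical coordinate with the horizontal ones).  So closed balls are compact,
    which gives completeness, and the dilatations, given in coordinates by sums,
    products, h and h^-1, are jointly continuous.  The same formula makes sense
    and is continuous at e = 0, where it returns the centre; this is A1. *)

(** * Metric spaces and their closed balls *)

Section MetricSpaces.
Context {R : realType} {X : metricType R}.
Implicit Types (x y : X) (K : set X).

Lemma mdist_continuous x : continuous (mdist x : X -> R).
Proof.
move=> y; apply/cvgrPdist_lt => e e0.
have /nbhs_ballP : nbhs y (ball y e) by exact: nbhsx_ballx.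
move=> -[d d0 yd]; near=> z.
have : ball y e z by near: z; exact: nbhsx_ballx.
rewrite ballEmdist/= => yz.
have := metric_triangle x y z; have := metric_triangle x z y.
rewrite (metric_sym z y) => h1 h2; rewrite ltr_norml; apply/andP; split; lra.
Unshelve. all: by end_near. Qed.

Lemma open_nbhs_ball x (r : R) : 0 < r -> open_nbhs x (ball x r : set X).
Proof.
move=> r0; split; last exact: ballxx.
rewrite openE => y; rewrite ballEmdist/= => xy.
apply/nbhs_ballP; exists (r - mdist x y); first by rewrite /= subr_gt0.
move=> z; rewrite !ballEmdist/=; have := metric_triangle x y z; lra.
Qed.

Lemma closed_cball x (r : R) : closed (cball x r).
Proof.
rewrite (_ : cball x r = mdist x @^-1` [set t | t <= r])//.
by apply: preimage_closed => [y _|]; [exact: mdist_continuous|exact: closed_le].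
Qed.

Lemma compact_subset_cball x K : compact K -> exists r, K `<=` cball x r.
Proof.
move=> Kc.
have : compact (mdist x @` K : set R).
  apply: continuous_compact Kc.
  exact/continuous_subspaceT/mdist_continuous.
move=> /compact_bounded [M [_ /(_ (M + 1) ltac:(lra)) h]].
exists (M + 1) => y Ky; rewrite /cball/=.
by apply: le_trans (ler_norm _) _; apply: h; exists y.
Qed.

(** A Cauchy filter contains a ball, hence a compact set, and a Cauchy filter
    converges to each of its cluster points. *)
Lemma proper_space_complete :
  (forall x (r : R), compact (cball x r)) ->
  forall F : set_system X, ProperFilter F -> cauchy F -> exists l : X, F --> l.
Proof.
move=> Kc F PF /cauchyP cF.
have [x Fx] := cF 1 ltr01.
have Fc : F (cball x 1).
  by apply: filterS Fx => y; rewrite ballEmdist/= /cball/=; exact: ltW.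
have [l [_ lF]] := Kc x 1 F PF Fc.
exists l; apply/fcvg_ballP => e e0.
have e3 : 0 < e / 3 by rewrite divr_gt0.
have [y Fy] := cF _ e3.
have [z []] := lF _ _ Fy (nbhsx_ballx l _ e3).
rewrite !ballEmdist/= => yz lz.
apply: filterS Fy => t; rewrite !ballEmdist/= => yt.
have := metric_triangle l z t; have := metric_triangle z y t.
rewrite (metric_sym z y); lra.
Qed.

End MetricSpaces.

(** * Dilatations that scale the distance to their centre *)

Section ConicalDilatations.
Context {R : realType} {X : metricType R}.
Variable delta : X -> R -> X -> X.
Hypothesis mdist_delta :
  forall x y e, 0 < e -> mdist x (delta x e y) = e * mdist x y.
Hypothesis delta1 : forall x y, delta x 1 y = y.
Hypothesis deltaM : axiom_A2 delta.
Hypothesis delta_continuous : forall x e, 0 < e -> continuous (delta x e).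

Lemma delta_center x e : 0 < e -> delta x e x = x.
Proof.
move=> e0; apply/esym/(@mdist_positivity R).
by rewrite mdist_delta// mdistxx mulr0.
Qed.

Lemma deltaK x e : 0 < e -> cancel (delta x e) (delta x e^-1).
Proof. by move=> e0 y; rewrite deltaM ?invr_gt0// mulVf ?gt_eqF. Qed.

Lemma deltaVK x e : 0 < e -> cancel (delta x e^-1) (delta x e).
Proof. by move=> e0 y; rewrite deltaM ?invr_gt0// mulfV ?gt_eqF. Qed.

Lemma delta_image_ball x e r : 0 < e ->
  delta x e @` ball x r = ball x (e * r).
Proof.
move=> e0; apply/seteqP; split=> [_ [y + <-]|y].
  by rewrite !ballEmdist/= mdist_delta// ltr_pM2l.
rewrite ballEmdist/= => xy; exists (delta x e^-1 y); last exact: deltaVK.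
by rewrite ballEmdist/= mdist_delta ?invr_gt0// mulrC ltr_pdivrMr// mulrC.
Qed.

Lemma delta_homeo_on x e (U V : set X) : 0 < e -> delta x e @` U = V ->
  homeo_on U V (delta x e).
Proof.
move=> e0 UV; split.
- split=> [y Uy|y z _ _ /(congr1 (delta x e^-1))|]; rewrite ?deltaK//.
  + by rewrite -UV; exists y.
  + by rewrite -UV.
- by apply: continuous_subspaceT; exact: delta_continuous.
- exists (delta x e^-1); last by move=> y _; exact: deltaK.
  by apply: continuous_subspaceT; apply: delta_continuous; rewrite invr_gt0.
Qed.

Lemma delta_homeo x e : 0 < e -> homeo_on setT setT (delta x e).
Proof.
move=> e0; apply: delta_homeo_on => //; apply/seteqP; split=> // y _.
by exists (delta x e^-1 y) => //; exact: deltaVK.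
Qed.

(** The radii 3 and 4 leave room for the closed ball of radius 2 inside [U x]
    and for the strict inequality of the last clause, where the distance is at
    most twice [e]. *)
Lemma conical_A0 : axiom_A0 delta 2 4.
Proof.
split; [lra|lra|].
exists (fun x => ball x 3), (fun x e => ball x (e * 3)),
  (fun x e => ball x (e^-1 * 4)); split.
- split=> [x|x e /andP[e0 _]|x e e1]; apply: open_nbhs_ball => //.
  + by rewrite mulr_gt0.
  + by rewrite mulr_gt0// invr_gt0; lra.
- by move=> x y; rewrite ballEmdist/= /cball/=; lra.
- move=> x e /andP[e0 _]; apply: delta_homeo_on => //; exact: delta_image_ball.
- move=> x e /andP[e0 _]; rewrite !delta_image_ball// invrK.
  by split=> //; apply: le_ball; nra.
- move=> K _; exists 1, (1 / 2); split; [lra|lra|].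
  move=> x u v e _; rewrite /cball/= ballEmdist/= invrK => xu xv /andP[e0 _].
  have := metric_triangle (delta x e u) x (delta x e v).
  rewrite (metric_sym _ x) !mdist_delta//; nra.
Qed.

(** By A2, [delta x e v] is the dilatation of the approximate difference around
    [delta x e u], so the scaling identity applies with this other centre. *)
Lemma mdist_approx_difference x e u v : 0 < e ->
  mdist (delta x e u) (delta x e v) =
  e * mdist (delta x e u) (approx_difference delta x e u v).
Proof.
by move=> e0; rewrite -mdist_delta// /approx_difference deltaVK.
Qed.

(** The limit distance is [d0 x u v = d (x, D x u v)], with [D] the limit in A4.
    Compactness of closed balls turns the uniformity of A4 on compact sets into
    uniformity over [x] in [K] and [u], [v] in the ball of radius [A]. *)
Lemma conical_A3 (A : R) :
  (forall (x : X) (r : R), compact (cball x r)) -> 1 < A ->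
  axiom_A4 delta -> axiom_A3 delta A.
Proof.
move=> cball_compact A1 [D DP]; split=> //.
exists (fun x u v => mdist x (D x u v)) => K Kc eta eta0.
have [->|/set0P[x0 _]] := eqVneq K set0; first by near=> e => x [].
(* All of [x], [u], [v] stay in the compact ball of radius [r + A]
   around [x0]. *)
have [r Kr] := compact_subset_cball x0 Kc.
have K'P x u : K x -> cball x A u -> cball x0 (r + A) u.
  move=> /Kr; rewrite /cball/=; have := metric_triangle x0 x u; lra.
have eta4 : 0 < eta / 4 by rewrite divr_gt0.
have HD := DP _ (cball_compact x0 (r + A)) _ eta4.
near=> e => x Kx.
have e0 : 0 < e by near: e; exact: nbhs_right_gt.
have eA : e < eta / 4 / A.
  by near: e; apply: nbhs_right_lt; rewrite divr_gt0//; lra.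
have {}eA : e * A < eta / 4 by rewrite -ltr_pdivlMr//; lra.
(* The supremum may equal its bound, hence a bound smaller than [eta]. *)
apply: (@le_lt_trans _ _ (eta / 2)%:E); last by rewrite lte_fin; lra.
apply: ge_ereal_sup => _ [[u v] [/= xu xv] <-]; rewrite lee_fin.
have Dx : mdist (approx_difference delta x e u v) (D x u v) < eta / 4.
  have : forall x u v, cball x0 (r + A) x -> cball x0 (r + A) u ->
    cball x0 (r + A) v ->
    mdist (approx_difference delta x e u v) (D x u v) < eta / 4.
    by near: e.
  apply; [apply: (K'P x)|exact: (K'P x)|exact: (K'P x)] => //.
  by rewrite /cball/= mdistxx; lra.
rewrite mdist_approx_difference// mulKf ?gt_eqF//.
set a := delta x e u; set b := approx_difference _ _ _ _ _.
have xa : mdist x a < eta / 4.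
  rewrite mdist_delta//; apply: le_lt_trans eA; rewrite ler_pM2l//.
have := metric_triangle a x b; have := metric_triangle x b (D x u v).
have := metric_triangle x a b; have := metric_triangle b (D x u v) x.
rewrite (metric_sym a x) (metric_sym b x) (metric_sym _ x).
rewrite ler_norml => h1 h2 h3 h4; apply/andP; split; lra.
Unshelve. all: by end_near. Qed.

End ConicalDilatations.

(** * Continuity on the line and in products *)

(** The preimage of the interval of radius [e] around [f t] is the open
    interval between the images under [h] of its ends. *)
Lemma increasing_bijection_continuous {R : realType} (f h : R -> R) :
  {mono f : s t / s <= t} -> cancel h f -> continuous f.
Proof.
move=> fm hK t; apply/cvgrPdist_lt => e e0.
have fml := leW_mono fm.
have lo : h (f t - e) < t by rewrite -fml hK; lra.
have hi : t < h (f t + e) by rewrite -fml hK; lra.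
near=> s.
have : h (f t - e) < s by near: s; exact: lt_nbhsr.
have : s < h (f t + e) by near: s; exact: lt_nbhsl.
rewrite -(fml s) -(fml _ s) !hK => h1 h2.
by rewrite ltr_norml; apply/andP; split; lra.
Unshelve. all: by end_near. Qed.

Lemma continuous_slice {T U V : topologicalType} (f : T * U -> V) (t : T) :
  continuous f -> continuous (fun u => f (t, u)).
Proof.
move=> cf u; apply: (continuous_comp _ (cf (t, u))).
by apply: cvg_pair; [exact: cvg_cst|exact: cvg_id].
Qed.

Lemma cvg_dominated {R : realType} {T : Type} {F : set_system T} {FF : Filter F}
    (f h : T -> R) (l : R) :
  (forall t, `|l - f t| <= h t) -> h t @[t --> F] --> (0 : R) ->
  f t @[t --> F] --> l.
Proof.
move=> fh /cvgrPdist_lt h0; apply/cvgrPdist_lt => e e0; near=> t.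
apply: le_lt_trans (fh t) _; apply: le_lt_trans (ler_norm _) _.
by rewrite -normrN -[- _]add0r; near: t; exact: h0.
Unshelve. all: by end_near. Qed.

Lemma cvg_enorm {R : realType} {T : Type} {F : set_system T} {FF : Filter F}
    (u v : T -> R) (a b : R) :
  u t @[t --> F] --> a -> v t @[t --> F] --> b ->
  enorm (u t, v t) @[t --> F] --> enorm (a, b).
Proof.
move=> ua vb; rewrite [enorm (a, b)]/enorm /= !expr2.
rewrite (_ : (fun t => enorm (u t, v t))
  = Num.sqrt \o (fun t => u t * u t + v t * v t)).
  apply: continuous_cvg; first exact: sqrt_continuous.
  exact: cvgD (cvgM ua ua) (cvgM vb vb).
by apply/funext => t /=; rewrite /enorm /= !expr2.
Qed.

Lemma enorm_ge1 {R : realType} (a b : R) : `|a| <= enorm (a, b).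
Proof. by rewrite -sqrtr_sqr ler_sqrt ?lerDl ?addr_ge0 ?sqr_ge0. Qed.

Lemma enorm_ge2 {R : realType} (a b : R) : `|b| <= enorm (a, b).
Proof. by rewrite -sqrtr_sqr ler_sqrt ?lerDr ?addr_ge0 ?sqr_ge0. Qed.

(** * The odd extension of the gauge and homogeneity *)

Section SignedGauge.
Context {R : realType} (k g : R -> R) (kg : gauge k g).

(** The odd extensions to the line of [g] and of its inverse; unlike [g], whose
    values at negative arguments are arbitrary, they are inverse bijections. *)
Definition signed_ginv (t : R) : R := Num.sg t * (k `|t| + `|t| ^+ 2).
Definition signed_g (s : R) : R := Num.sg s * g `|s|.

Lemma gauge_g0 : g 0 = 0.
Proof.
by have := gauge_gK kg (lexx 0); rewrite (gauge_k0 kg) expr0n addr0.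
Qed.

Lemma gauge_g_gt0 (s : R) : 0 < s -> 0 < g s.
Proof.
move=> s0; rewrite lt_neqAle (gauge_g_ge0 kg) ?ltW// andbT.
apply: contraTN s0 => /eqP g0; have := gauge_Kg kg (s := s).
rewrite -g0 (gauge_k0 kg) => h; rewrite -leNgt leNgt; apply/negP => s0.
by have := h (ltW s0); rewrite expr0n addr0; lra.
Qed.

Lemma gauge_ginv_lt (s t : R) : 0 <= s -> s < t -> k s + s ^+ 2 < k t + t ^+ 2.
Proof.
move=> s0 st; have := gauge_k_incr kg (x := s) (y := t).
rewrite !in_itv/= !andbT => /(_ s0 _ st); nra.
Qed.

Lemma gauge_ginv_gt0 (t : R) : 0 < t -> 0 < k t + t ^+ 2.
Proof.
by move/(gauge_ginv_lt (lexx 0)); rewrite (gauge_k0 kg) expr0n addr0.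
Qed.

Lemma signed_gK : cancel signed_g signed_ginv.
Proof.
move=> s; rewrite /signed_ginv /signed_g.
have [->|s0] := eqVneq s 0; first by rewrite sgr0 mul0r sgr0 mul0r.
have gs : 0 < g `|s| by rewrite gauge_g_gt0// normr_gt0.
rewrite normrM sgrM normr_sg s0 mul1r (gtr0_norm gs) (gtr0_sg gs) mulr1.
by rewrite sgr_id (gauge_Kg kg)// -numEsg.
Qed.

Lemma signed_ginvK : cancel signed_ginv signed_g.
Proof.
move=> t; rewrite /signed_ginv /signed_g.
have [->|t0] := eqVneq t 0; first by rewrite sgr0 mul0r sgr0 mul0r.
have kt : 0 < k `|t| + `|t| ^+ 2 by rewrite gauge_ginv_gt0// normr_gt0.
rewrite normrM sgrM normr_sg t0 mul1r (gtr0_norm kt) (gtr0_sg kt) mulr1.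
by rewrite sgr_id (gauge_gK kg)// -numEsg.
Qed.

Lemma signed_ginv_ge0 (t : R) : 0 <= t -> signed_ginv t = k t + t ^+ 2.
Proof.
rewrite le_eqVlt /signed_ginv => /predU1P[<-|t0].
  by rewrite sgr0 mul0r (gauge_k0 kg) expr0n addr0.
by rewrite (gtr0_sg t0) (gtr0_norm t0) mul1r.
Qed.

Lemma signed_ginvN (t : R) : signed_ginv (- t) = - signed_ginv t.
Proof. by rewrite /signed_ginv sgrN normrN mulNr. Qed.

Lemma signed_ginv_mono : {mono signed_ginv : s t / s <= t}.
Proof.
apply: le_mono => s t st.
have lt0 u v : 0 <= u -> u < v -> signed_ginv u < signed_ginv v.
  move=> u0 uv; rewrite !signed_ginv_ge0//; first exact: gauge_ginv_lt.
  exact: ltW (le_lt_trans u0 uv).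
have s0 : signed_ginv 0 = 0 by rewrite /signed_ginv sgr0 mul0r.
have [s_ge0|s_lt0] := leP 0 s; first exact: lt0.
have neg : signed_ginv s < 0.
  rewrite -(opprK s) signed_ginvN oppr_lt0 -s0; apply: lt0 => //; lra.
have [t_gt0|t_le0] := ltP 0 t.
  by apply: lt_trans neg _; rewrite -s0; exact: lt0.
rewrite -(opprK s) -(opprK t) signed_ginvN (signed_ginvN (- t)) ltrN2.
by apply: lt0; lra.
Qed.

Lemma signed_ginv_continuous : continuous signed_ginv.
Proof.
exact: increasing_bijection_continuous signed_ginv_mono signed_gK.
Qed.

Lemma signed_g_continuous : continuous signed_g.
Proof.
apply: increasing_bijection_continuous signed_ginvK.
exact: can_mono signed_gK signed_ginv_mono.
Qed.

Lemma cvg_signed_ginv {T : Type} {F : set_system T} {FF : Filter F}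
    (u : T -> R) (a : R) :
  u t @[t --> F] --> a -> signed_ginv (u t) @[t --> F] --> signed_ginv a.
Proof. by apply: continuous_cvg; exact: signed_ginv_continuous. Qed.

Lemma cvg_signed_g {T : Type} {F : set_system T} {FF : Filter F}
    (u : T -> R) (a : R) :
  u t @[t --> F] --> a -> signed_g (u t) @[t --> F] --> signed_g a.
Proof. by apply: continuous_cvg; exact: signed_g_continuous. Qed.

Lemma signed_g0 : signed_g 0 = 0.
Proof. by rewrite /signed_g sgr0 mul0r. Qed.

Lemma signed_ginv0 : signed_ginv 0 = 0.
Proof. by rewrite /signed_ginv sgr0 mul0r. Qed.

(** The bound of [vertical_le] vanishes with the distance. *)
Lemma cvg_vertical_bound {T : Type} {F : set_system T} {FF : Filter F}
    (d : T -> R) (c : R) : d t @[t --> F] --> (0 : R) ->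
  signed_ginv (d t) + 2 * c * d t @[t --> F] --> (0 : R).
Proof.
move=> d0.
rewrite (_ : 0 = signed_ginv 0 + 2 * c * 0); last first.
  by rewrite signed_ginv0 mulr0 addr0.
apply: cvgD; first exact: cvg_signed_ginv.
by apply: cvgM => //; exact: cvg_cst.
Qed.

Lemma gauge_g_norm (s : R) : g `|s| = `|signed_g s|.
Proof.
rewrite /signed_g normrM normr_sg (ger0_norm (gauge_g_ge0 kg _))//.
by case: eqP => [->|_]; rewrite ?normr0 ?gauge_g0 ?mulr0// mul1r.
Qed.

(** The odd extension conjugates the vertical part of a dilatation to the
    multiplication by [e]; the group law, the homogeneity and the continuity of
    dilatations are read off this form. *)
Lemma hdil0E (e : R) (x : heisenberg R) : 0 <= e ->
  hdil0 k g e x = (e * x.1.1, e * x.1.2, signed_ginv (e * signed_g x.2)).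
Proof.
move=> e0; rewrite /hdil0; congr (_, _, _).
rewrite /signed_ginv normrM (ger0_norm e0) -gauge_g_norm sgrM.
have [->|x0] := eqVneq x.2 0.
  by rewrite sgr0 signed_g0 sgr0 mulr0 !mul0r.
rewrite /signed_g sgrM sgr_id.
rewrite (gtr0_sg (gauge_g_gt0 _)) ?normr_gt0// mulr1.
move: e0; rewrite le_eqVlt => /predU1P[<-|e0].
  by rewrite sgr0 !mul0r (gauge_k0 kg) expr0n addr0 mulr0.
by rewrite (gtr0_sg e0) mul1r.
Qed.

Lemma hdil01 (x : heisenberg R) : hdil0 k g 1 x = x.
Proof.
by rewrite hdil0E// !mul1r signed_gK; case: x => [[]].
Qed.

Lemma hdil0M (e m : R) (x : heisenberg R) : 0 <= e -> 0 <= m ->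
  hdil0 k g e (hdil0 k g m x) = hdil0 k g (e * m) x.
Proof.
by move=> e0 m0; rewrite !hdil0E ?mulr_ge0//= signed_ginvK !mulrA.
Qed.

Lemma hgauge_hdil0 (e : R) (x : heisenberg R) : 0 <= e ->
  hgauge g (hdil0 k g e x) = e * hgauge g x.
Proof.
move=> e0; rewrite hdil0E// /hgauge/= maxr_pMr// !gauge_g_norm signed_ginvK.
rewrite normrM (ger0_norm e0); congr Num.max.
rewrite /enorm/= !exprMn -mulrDr sqrtrM ?sqr_ge0// sqrtr_sqr.
by rewrite (ger0_norm e0).
Qed.

Lemma hdist_hdil (x y : heisenberg R) (e : R) : 0 <= e ->
  hdist g x (hdil k g x e y) = e * hdist g x y.
Proof. by move=> e0; rewrite /hdist /hdil mulKg hgauge_hdil0. Qed.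

Lemma hdil1 (x y : heisenberg R) : hdil k g x 1 y = y.
Proof. by rewrite /hdil hdil01 mulVKg. Qed.

Lemma hdilM (x y : heisenberg R) (e m : R) : 0 <= e -> 0 <= m ->
  hdil k g x e (hdil k g x m y) = hdil k g x (e * m) y.
Proof. by move=> e0 m0; rewrite /hdil mulKg hdil0M. Qed.

End SignedGauge.

(** * The topology of the Heisenberg distance *)

Section HeisenbergTopology.
Context {R : realType} (k g : R -> R) (kg : gauge k g).
Local Notation M := (heisenberg_metric kg).

(** The identity map, in both directions: each type selects its topology, the
    metric one on [M] and the product one on triples. *)
Definition of_coords (p : R * R * R) : M := p.
Definition coords (x : M) : R * R * R := x.

Lemma mdistE (x y : M) :
  mdist x y =
  Num.max (enorm ((coords y).1.1 - (coords x).1.1,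
                  (coords y).1.2 - (coords x).1.2))
          `|signed_g g ((coords y).2 - (coords x).2
                      - 2 * symp (coords x).1 (coords y).1)|.
Proof.
rewrite -(gauge_g_norm kg) [LHS](_ : _ = hdist g x y)//.
rewrite /hdist /hgauge /coords/=; congr Num.max.
  by congr (enorm (_, _)); rewrite addrC.
by congr (g `| _ |); rewrite /symp/=; ring.
Qed.

Lemma of_coords_continuous : continuous of_coords.
Proof.
move=> p; apply/cvg_ballP => e e0; under eq_near do rewrite ballEmdist/= mdistE.
rewrite /coords /of_coords.
(* The two terms of the distance to [p]; both are continuous for the usual
   topology and vanish at [p]. *)
pose E (q : R * R * R) := enorm (q.1.1 - p.1.1, q.1.2 - p.1.2).
pose V (q : R * R * R) :=
  `|signed_g g (q.2 - p.2 - 2 * symp p.1 q.1)|.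
have c11 : continuous (fun q : R * R * R => q.1.1).
  by move=> q; apply: (cvg_comp _ _ (@cvg_fst _ _ _ _ _)); exact: cvg_fst.
have c12 : continuous (fun q : R * R * R => q.1.2).
  by move=> q; apply: (cvg_comp _ _ (@cvg_fst _ _ _ _ _)); exact: cvg_snd.
have c2 : continuous (fun q : R * R * R => q.2) by move=> q; exact: cvg_snd.
have E0 : E p = 0 by rewrite /E !subrr /enorm expr0n addr0 sqrtr0.
have V0 : V p = 0.
  rewrite /V /symp subrr [X in signed_g _ X](_ : _ = 0) ?signed_g0 ?normr0//.
  by ring.
have cE : E q @[q --> p] --> E p.
  apply: cvg_enorm.
    exact: cvgB (c11 p) (cvg_cst p.1.1).
  exact: cvgB (c12 p) (cvg_cst p.1.2).
have cV : V q @[q --> p] --> V p.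
  apply: cvg_norm; apply: (cvg_signed_g kg).
  apply: cvgB; first by apply: cvgB; [exact: c2|exact: cvg_cst].
  apply: cvgM; first exact: cvg_cst.
  by apply: cvgB; apply: cvgM; (exact: c11 || exact: c12 || exact: cvg_cst).
rewrite E0 in cE; rewrite V0 in cV.
near=> q; rewrite gt_max; apply/andP; split.
- apply: le_lt_trans (ler_norm _) _; rewrite -normrN -[- _]add0r.
  by near: q; move/cvgrPdist_lt: cE; exact.
- apply: le_lt_trans (ler_norm _) _; rewrite -normrN -[- _]add0r.
  by near: q; move/cvgrPdist_lt: cV; exact.
Unshelve. all: by end_near. Qed.

Lemma cvg_of_coords {T : Type} {F : set_system T} {FF : Filter F}
    (a b c : T -> R) (la lb lc : R) :
  a t @[t --> F] --> la -> b t @[t --> F] --> lb -> c t @[t --> F] --> lc ->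
  of_coords (a t, b t, c t) @[t --> F] --> of_coords (la, lb, lc).
Proof.
move=> ha hb hc.
have habc : (a t, b t, c t) @[t --> F] --> ((la, lb, lc) : R * R * R).
  exact: (cvg_pair (cvg_pair ha hb) hc).
by apply: continuous_cvg habc; exact: of_coords_continuous.
Qed.

Lemma mdist_ge_enorm (x y : M) :
  enorm ((coords y).1.1 - (coords x).1.1, (coords y).1.2 - (coords x).1.2)
  <= mdist x y.
Proof. by rewrite mdistE le_max lexx. Qed.

(** The vertical part of [x^-1 y] differs from the difference of the vertical
    coordinates by the symplectic term, which can be evaluated on the difference
    of the horizontal parts because the form is alternating; this is what makes
    it small with the distance. *)
Lemma vertical_le (x y : M) :
  `|(coords x).2 - (coords y).2| <=
  signed_ginv k (mdist x y) + 2 * enorm (coords x).1 * mdist x y.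
Proof.
set w := (coords y).2 - (coords x).2 - 2 * symp (coords x).1 (coords y).1.
pose d := ((coords y).1.1 - (coords x).1.1, (coords y).1.2 - (coords x).1.2).
have -> : (coords x).2 - (coords y).2 = - (w + 2 * symp (coords x).1 d).
  by rewrite /w /symp /d/=; ring.
rewrite normrN; apply: le_trans (ler_normD _ _) _; apply: lerD.
  have -> : `|w| = signed_ginv k (g `|w|).
    by rewrite (signed_ginv_ge0 kg) ?(gauge_Kg kg)// (gauge_g_ge0 kg).
  by rewrite (signed_ginv_mono kg) mdistE le_max (gauge_g_norm kg) lexx orbT.
rewrite normrM ger0_norm// -mulrA ler_pM2l//.
apply: le_trans (symp_le _ _) _; rewrite ler_wpM2l ?enorm_ge0//.
exact: mdist_ge_enorm.
Qed.

Lemma mdist_cvg0 (x : M) : mdist x y @[y --> x] --> (0 : R).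
Proof.
by have := @mdist_continuous _ _ x x; rewrite /continuous_at mdistxx.
Qed.

Lemma coord11_continuous : continuous (fun x : M => (coords x).1.1).
Proof.
move=> x; apply: cvg_dominated (mdist_cvg0 x) => y.
by rewrite distrC (le_trans (enorm_ge1 _ _) (mdist_ge_enorm _ _)).
Qed.

Lemma coord12_continuous : continuous (fun x : M => (coords x).1.2).
Proof.
move=> x; apply: cvg_dominated (mdist_cvg0 x) => y.
by rewrite distrC (le_trans (enorm_ge2 _ _) (mdist_ge_enorm _ _)).
Qed.

Lemma coord2_continuous : continuous (fun x : M => (coords x).2).
Proof.
move=> x; apply: (@cvg_dominated _ _ (nbhs x) _ _ _ _ (vertical_le x)).
exact: (cvg_vertical_bound kg _ (mdist_cvg0 x)).
Qed.

(** A closed ball lies in the image of a box: a point at distance at most [m]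
    from the origin has horizontal coordinates bounded by [m] and vertical
    coordinate bounded by [signed_ginv m]. *)
Lemma cball_heisenberg_compact (x : M) (r : R) : compact (cball x r).
Proof.
pose m := Num.norm (mdist (of_coords 0) x + r).
pose I (b : R) : set R := `[- b, b]%classic.
pose Q : set (R * R * R) := I m `*` I m `*` I (signed_ginv k m).
have Qc : compact (of_coords @` Q).
  apply: continuous_compact.
    exact/continuous_subspaceT/of_coords_continuous.
  by apply: compact_setX; [apply: compact_setX|]; exact: segment_compact.
apply: subclosed_compact Qc _; first exact: closed_cball.
move=> y; rewrite /cball/= => xy; exists (coords y) => //.
have d0 : mdist (of_coords 0) y <= m.
  apply: le_trans (metric_triangle _ x _) _.
  by apply: le_trans (ler_norm _); rewrite lerD2l.
have hE := mdist_ge_enorm (of_coords 0) y.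
rewrite /= !subr0 in hE.
have hV := vertical_le (of_coords 0) y.
have e0 : enorm (coords (of_coords 0)).1 = 0 :> R.
  by rewrite /enorm/= expr0n addr0 sqrtr0.
rewrite e0 mulr0 mul0r addr0 /= sub0r normrN in hV.
rewrite /Q/I/=; split; first split.
- rewrite /= in_itv/= -ler_norml; apply: le_trans d0; apply: le_trans hE.
  exact: enorm_ge1.
- rewrite /= in_itv/= -ler_norml; apply: le_trans d0; apply: le_trans hE.
  exact: enorm_ge2.
- rewrite /= in_itv/= -ler_norml; apply: le_trans hV _.
  by rewrite (signed_ginv_mono kg).
Qed.

(** The dilatation written in coordinates, as a function of coefficient, centre
    and point together.  It is continuous for every real coefficient, and at 0
    it is the limit required by A1. *)
Definition hdil_ext (p : R * M * M) : M :=
  let e := p.1.1 in let x := coords p.1.2 in let y := coords p.2 in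
  let z := (y.1.1 - x.1.1, y.1.2 - x.1.2) in
  of_coords (x.1.1 + e * z.1, x.1.2 + e * z.2,
    x.2 + signed_ginv k (e * signed_g g
                                  (y.2 - x.2 - 2 * symp x.1 y.1))
    + 2 * symp x.1 (e * z.1, e * z.2)).

Lemma hdil_extE (e : R) (x y : M) : 0 <= e ->
  hdil_ext (e, x, y) = heisenberg_dil x e y.
Proof.
move=> e0; rewrite /heisenberg_dil /hdil hdil0E// /hdil_ext /of_coords /coords.
case: x => [[x1 x2] x3]; case: y => [[y1 y2] y3] /=.
rewrite /hmul /=.
rewrite (_ : - x3 + y3 + _ = y3 - x3 - 2 * symp (x1, x2) (y1, y2)).
  by congr (_, _, _); rewrite /symp /=; ring.
by rewrite /symp/=; ring.
Qed.

Lemma hdil_ext0 (x y : M) : hdil_ext (0, x, y) = x.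
Proof.
rewrite /hdil_ext /of_coords /coords.
case: x => [[x1 x2] x3]; case: y => [[y1 y2] y3] /=.
by rewrite !mul0r signed_ginv0 /symp/= !mulr0 subrr mulr0 !addr0.
Qed.

Lemma hdil_ext_continuous : continuous hdil_ext.
Proof.
move=> p.
have ce : q.1.1 @[q --> p] --> p.1.1.
  by apply: (cvg_comp _ _ (@cvg_fst _ _ _ _ _)); exact: cvg_fst.
have cx : q.1.2 @[q --> p] --> p.1.2.
  by apply: (cvg_comp _ _ (@cvg_fst _ _ _ _ _)); exact: cvg_snd.
have cy : q.2 @[q --> p] --> p.2 by exact: cvg_snd.
have cx1 : (coords q.1.2).1.1 @[q --> p] --> (coords p.1.2).1.1.
  exact: (continuous_cvg _ (@coord11_continuous _) cx).
have cx2 : (coords q.1.2).1.2 @[q --> p] --> (coords p.1.2).1.2.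
  exact: (continuous_cvg _ (@coord12_continuous _) cx).
have cx3 : (coords q.1.2).2 @[q --> p] --> (coords p.1.2).2.
  exact: (continuous_cvg _ (@coord2_continuous _) cx).
have cy1 : (coords q.2).1.1 @[q --> p] --> (coords p.2).1.1.
  exact: (continuous_cvg _ (@coord11_continuous _) cy).
have cy2 : (coords q.2).1.2 @[q --> p] --> (coords p.2).1.2.
  exact: (continuous_cvg _ (@coord12_continuous _) cy).
have cy3 : (coords q.2).2 @[q --> p] --> (coords p.2).2.
  exact: (continuous_cvg _ (@coord2_continuous _) cy).
have cz1 : q.1.1 * ((coords q.2).1.1 - (coords q.1.2).1.1) @[q --> p] -->
    p.1.1 * ((coords p.2).1.1 - (coords p.1.2).1.1).
  exact: (cvgM ce (cvgB cy1 cx1)).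
have cz2 : q.1.1 * ((coords q.2).1.2 - (coords q.1.2).1.2) @[q --> p] -->
    p.1.1 * ((coords p.2).1.2 - (coords p.1.2).1.2).
  exact: (cvgM ce (cvgB cy2 cx2)).
apply: cvg_of_coords.
- exact: cvgD cx1 cz1.
- exact: cvgD cx2 cz2.
- apply: cvgD.
    apply: cvgD => //; apply: (cvg_signed_ginv kg) => //.
    apply: cvgM => //; apply: (cvg_signed_g kg) => //.
    apply: cvgB; first exact: cvgB.
    by apply: cvgM; [exact: cvg_cst|apply: cvgB; exact: cvgM].
  by apply: cvgM; [exact: cvg_cst|apply: cvgB; exact: cvgM].
Qed.

Lemma heisenberg_dil_continuous (x : M) (e : R) : 0 < e ->
  continuous (heisenberg_dil x e : M -> M).
Proof.
move=> e0.
rewrite (_ : heisenberg_dil x e = hdil_ext \o (fun y => (e, x, y))).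
  exact/continuous_slice/hdil_ext_continuous.
by apply/funext => y /=; rewrite hdil_extE// ltW.
Qed.

Lemma mdist_hdil (x y : M) (e : R) : 0 < e ->
  mdist x (heisenberg_dil x e y) = e * mdist x y.
Proof. by move=> e0; exact: (hdist_hdil kg x y (ltW e0)). Qed.

Lemma heisenberg_A2 : axiom_A2 (heisenberg_dil (kg := kg)).
Proof.
by move=> x y e m e0 m0; exact: (hdilM kg x y (ltW e0) (ltW m0)).
Qed.

Lemma heisenberg_A1 : axiom_A1 (heisenberg_dil (kg := kg)).
Proof.
split.
- by move=> x e; exact: (delta_center mdist_hdil).
- exact: hdil1.
- apply: (@subspace_eq_continuous _ _ _ hdil_ext).
    by move=> [[e x] y]; rewrite inE/= => e0; rewrite hdil_extE// ltW.
  exact/continuous_subspaceT/hdil_ext_continuous.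
- apply: (@subspace_eq_continuous _ _ _ hdil_ext).
    move=> [[e x] y]; rewrite inE/= le_eqVlt => /predU1P[<-|e0].
      by rewrite hdil_ext0 /from_subspace/= ltxx.
    by rewrite /from_subspace/= e0 hdil_extE// ltW.
  exact/continuous_subspaceT/hdil_ext_continuous.
Qed.

End HeisenbergTopology.

Unset Implicit Arguments.

Theorem proposition3p2 (R : realType) (k g : R -> R) (kg : gauge k g) :
  let delta := heisenberg_dil (kg := kg) in
  dilatation_setting delta /\
  exists A B : R,
    [/\ axiom_A0 delta A B, axiom_A1 delta, axiom_A2 delta &
        axiom_A4 delta -> axiom_A3 delta A].
Proof.
move=> delta.
have A1 := heisenberg_A1 kg.
have A2 := @heisenberg_A2 R k g kg.
have conical := @mdist_hdil R k g kg.
have delta_cont := @heisenberg_dil_continuous R k g kg.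
have cball_compact := @cball_heisenberg_compact R k g kg.
have [_ delta1 _ _] := A1.
split; first split.
- exact: proper_space_complete cball_compact.
- exact: cball_compact.
- by move=> x e; exact: delta_homeo.
- exists 2, 4; split => //; first exact: conical_A0.
  by apply: conical_A3 => //; lra.
Qed.
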